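(* Let $G$ and $H$ be finite acyclic directed graphs. If $\mathrm{top}(G)\simeq\mathcal L(H)$ as posets, then $G\simeq H$ as directed graphs.
   Context: All directed graphs are finite, acyclic (no directed cycles, hence no loops) and without multiple edges; $g\in G$ means $g$ is a vertex of $G$, and $g\to h$ denotes an edge from $g$ to $h$. The $G$-order is the partial order on vertices with $g_1\ge g_2$ iff there is a directed path (possibly of length $0$) from $g_1$ to $g_2$. An independent set is a set of pairwise non-adjacent vertices. A pair $(\mathcal D,\mathcal U)$ of disjoint independent sets is orthogonal if there is no edge from an element of $\mathcal D$ to an element of $\mathcal U$. An orthogonal pair of independent sets is tight if none of the following operations results in an orthogonal pair of independent sets: removing some $d\in\mathcal D$ and inserting in $\mathcal D$ an element $d'\notin\mathcal D$ with $d'>d$; removing some $u\in\mathcal U$ and inserting in $\mathcal U$ an element $u'\notin\mathcal U$ with $u'<u$; adding a new element to $\mathcal D$; adding a new element to $\mathcal U$. A tight orthogonal pair is called a top, and $\mathrm{top}(G)$ is the set of tops of $G$. A linear extension $\ell$ of $G$-order is a total order on the vertices such that if $g_1\to g_2$ is an edge then $g_2$ precedes $g_1$; a reverse linear extension $\ell'$ is a total order in which $g_1$ precedes $g_2$ whenever $g_1\to g_2$. Flips: for $(\mathcal D,\mathcal U)\in\mathrm{top}(G)$ and $g\in G$, define $\mathrm{flip}_g(\mathcal D,\mathcal U)=(\mathcal D,\mathcal U)$ if $g\notin\mathcal D\cup\mathcal U$. Otherwise start with $\mathcal D'=\{k\in\mathcal D: k\not\le g\}$ and $\mathcal U'=\{k\in\mathcal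 U:k\not\ge g\}$; add $g$ to $\mathcal D'$ if $g\in\mathcal U$, and add $g$ to $\mathcal U'$ if $g\in\mathcal D$. Then, for $k\not\ge g$ in the order of a reverse linear extension $\ell'$, add $k$ to $\mathcal D'$ if $k\notin\mathcal U'$, there is no edge from $k$ to $\mathcal U'$, and there is no edge from the current $\mathcal D'$ to $k$. Then, for $k\not\le g$ in the order of a linear extension $\ell$, add $k$ to $\mathcal U'$ if $k\notin\mathcal D'$, there is no edge from $\mathcal D'$ to $k$, and there is no edge from $k$ to the current $\mathcal U'$. The result $(\mathcal D',\mathcal U')$ is $\mathrm{flip}_g(\mathcal D,\mathcal U)$; it is a top and does not depend on the choice of $\ell,\ell'$. The independence poset, also denoted $\mathrm{top}(G)$, is the set $\mathrm{top}(G)$ with the reflexive and transitive closure of the relations $(\mathcal D,\mathcal U)<\mathrm{flip}_g(\mathcal D,\mathcal U)$ for $g\in\mathcal U$ (this is a partial order). Maximal orthogonal pairs: a pair $(X,Y)$ of disjoint sets of vertices of $H$ (not necessarily independent) with no edge from an element of $X$ to an element of $Y$ is a maximal orthogonal pair if $X$ and $Y$ are both maximal with this property. $\mathcal L(H)$ is the set of maximal orthogonal pairs of $H$ ordered by $(X,Y)\le(X',Y')$ iff $X\subseteq X'$ (equivalently $Y'\subseteq Y$); it is a lattice. *)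

(* Defs.v *)
(* Independence posets and lattices of maximal orthogonal pairs of finite
   acyclic directed graphs, in MathComp.

   A directed graph is a finite vertex type T with an edge relation e : rel T;
   multiple edges are excluded by construction. *)

From Stdlib Require Import Relation_Operators.
From mathcomp Require Import all_boot.

Set Implicit Arguments.
Unset Strict Implicit.
Unset Printing Implicit Defensive.

(* [cycle e c] requires an edge from the last element of c back to the first,
   so [cycle e [:: x]] is a loop at x, while [cycle e [::]] always holds. *)
Definition acyclic (T : finType) (e : rel T) : Prop :=
  forall c : seq T, cycle e c -> c = [::].

Section Digraph.

Variables (T : finType) (e : rel T).

Implicit Types (A D U X Y : {set T}) (P : {set T} * {set T}).

(* The G-order: the larger vertex is the source of the directed path. *)
Definition gle (x y : T) : bool := connect e y x.
Definition glt (x y : T) : bool := (x != y) && gle x y.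

Definition independent A : bool :=
  [forall x in A, forall y in A, ~~ e x y].

Definition no_edge X Y : bool :=
  [forall x in X, forall y in Y, ~~ e x y].

Definition orthogonal D U : bool :=
  [&& independent D, independent U, [disjoint D & U] & no_edge D U].

Definition tight D U : bool :=
  [&& [forall d in D, forall (d' | d' \notin D),
         glt d d' ==> ~~ orthogonal (d' |: (D :\ d)) U],
      [forall u in U, forall (u' | u' \notin U),
         glt u' u ==> ~~ orthogonal D (u' |: (U :\ u))],
      [forall (d' | d' \notin D), ~~ orthogonal (d' |: D) U]
    & [forall (u' | u' \notin U), ~~ orthogonal D (u' |: U)]].

Definition is_top P : bool := orthogonal P.1 P.2 && tight P.1 P.2.

Definition top : Type := {P : {set T} * {set T} | is_top P}.

(* A total order on the vertices is given by the sequence l listing each vertex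
   exactly once; x precedes y when [index x l < index y l]. *)
Definition linear_extension (l : seq T) : Prop :=
  perm_eq l (enum T) /\ (forall x y, e x y -> index y l < index x l).

Definition reverse_linear_extension (l : seq T) : Prop :=
  perm_eq l (enum T) /\ (forall x y, e x y -> index x l < index y l).

Definition complete_down U D (s : seq T) : {set T} :=
  foldl (fun D' k =>
    if [&& k \notin U, no_edge [set k] U & no_edge D' [set k]]
    then k |: D' else D') D s.

Definition complete_up D U (s : seq T) : {set T} :=
  foldl (fun U' k =>
    if [&& k \notin D, no_edge D [set k] & no_edge [set k] U']
    then k |: U' else U') U s.

(* The flip at g computed with the linear extension l and the reverse linear
   extension l'. *)
Definition flip (l l' : seq T) (g : T) P : {set T} * {set T} :=
  let: (D, U) := P in
  if g \notin D :|: U then (D, U) else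
  let D0 := [set k in D | ~~ gle k g] in
  let U0 := [set k in U | ~~ gle g k] in
  let D1 := if g \in U then g |: D0 else D0 in
  let U1 := if g \in D then g |: U0 else U0 in
  let D2 := complete_down U1 D1 [seq k <- l' | ~~ gle g k] in
  let U2 := complete_up D2 U1 [seq k <- l | ~~ gle k g] in
  (D2, U2).

(* [flip l l' g P] does not depend on l and l' when P is a top, so flipping is
   recorded as a relation, which avoids singling out one pair (l, l'). *)
Definition flip_step (p q : top) : Prop :=
  exists (g : T) (l l' : seq T),
    [/\ g \in (sval p).2, linear_extension l, reverse_linear_extension l'
      & sval q = flip l l' g (sval p)].

Definition top_le : top -> top -> Prop := clos_refl_trans top flip_step.

Definition weakly_orthogonal X Y : bool := [disjoint X & Y] && no_edge X Y.

Definition is_mop P : bool :=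
  maxset (fun X => weakly_orthogonal X P.2) P.1
  && maxset (fun Y => weakly_orthogonal P.1 Y) P.2.

Definition mop : Type := {P : {set T} * {set T} | is_mop P}.

Definition mop_le (p q : mop) : Prop := (sval p).1 \subset (sval q).1.

End Digraph.

Definition rel_iso (A B : Type) (leA : A -> A -> Prop) (leB : B -> B -> Prop)
    : Prop :=
  exists2 f : A -> B, bijective f & forall x y, leA x y <-> leB (f x) (f y).

Definition digraph_iso (T1 T2 : finType) (e1 : rel T1) (e2 : rel T2) : Prop :=
  rel_iso (fun x y => e1 x y) (fun x y => e2 x y).

(* Main.v *)
Require Import Defs.
From Stdlib Require Import Relation_Operators Operators_Properties.
From Stdlib Require Import Classical ClassicalEpsilon.
From mathcomp Require Import all_boot.

(** The theorem is true because both posets display their digraph in the same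
    way. Say that a poset is represented by a digraph e if it contains a join-dense
    family j and a meet-dense family m, both indexed by the vertices, such that
    j x <= m y holds exactly when x and y are distinct and there is no edge from x
    to y. For acyclic digraphs such a representation is rigid: the elements j x are
    the same for any two representations of one poset, so are the elements m y, and
    the two resulting bijections of the vertices coincide, since otherwise one of
    the digraphs would have a cycle ([represents_iso]).

    Maximal orthogonal pairs are the formal concepts of the relation that holds
    for distinct x and y without an edge from x to y, so their lattice is represented by H
    ([mop_represents]). It remains to see that top(G), being a lattice through the
    given isomorphism, is represented by G ([tops_represents]). Here j x is the top
    with first set {x}, and m y is the top with second set {y}.

    The tightness condition alone is too weak to work with, as it allows tops in
    which some vertex is neither chosen nor blocked. The result of a flip never has
    this defect ([flip_complete]), so such tops would be minimal elements; since a
    lattice has only one, they are absent ([bottom_all_complete]). The remaining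
    pairs, called complete, are determined by either component, and a flip of one
    at g is the unique complete pair that gains g in the first set and agrees with
    the old pair off the vertices below g, respectively above g ([flip_exchange],
    [exchange_unique]). This description is invariant under reversing all edges
    and swapping the two sets, which reverses the order; every statement below
    therefore has a dual for free.

    If y is not in the first set of a top P and receives no edge from it, then
    P <= m y: flip upwards until only y is left in the second set ([le_meet_irr]).
    The converse uses meets ([le_meet_irr_inv]). One confines the second set to an
    up-closed region A and flips P at a minimal vertex of A; this step is a covering
    relation, as a weight that increases along flips shows ([flip_minimal_cover]),
    and the meet of its result with m y is strictly above P. So P can be moved
    upwards, staying below m y, until y is the only minimal vertex of A. Taking
    P = j x gives the description of j x <= m y. Density follows: if the meet of X
    and Y is not X, it lies below a top from which X arises by a flip at some d,
    while j d is below X but not below that top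
    ([join_dense_tops]). *)

Set Implicit Arguments.
Unset Strict Implicit.
Unset Printing Implicit Defensive.

(** * Reversing edges and the order on vertices *)

Definition converse (T : Type) (e : rel T) : rel T := fun x y => e y x.

Section Order.

Variables (T : finType) (e : rel T).

Lemma gle_refl x : gle e x x.
Proof. exact: connect0. Qed.

Lemma gle_trans y x z : gle e x y -> gle e y z -> gle e x z.
Proof. by move=> xy yz; apply: connect_trans yz xy. Qed.

Lemma gle_edge x y : e x y -> gle e y x.
Proof. exact: connect1. Qed.

Lemma gle_converse x y : gle (converse e) x y = gle e y x.
Proof.
suff imp (r : rel T) a b : connect r a b -> connect (converse r) b a.
  by apply/idP/idP; exact: imp.
case/connectP=> p; elim: p a => [|c p IHp] a /=; first by move=> _ ->; apply: connect0.
by case/andP=> rac /IHp/[apply] bc; apply: connect_trans bc (connect1 rac).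
Qed.

Hypothesis acyclic_e : acyclic e.

Lemma edge_irrefl x : e x x = false.
Proof.
by apply/negP=> exx; have := @acyclic_e [:: x]; rewrite /= exx => /(_ isT).
Qed.

Lemma gle_anti x y : gle e x y -> gle e y x -> x = y.
Proof.
case/connectP=> p path_p last_p /connectP[q path_q last_q].
have: path e y (p ++ q) by rewrite cat_path path_p -last_p.
have: last y (p ++ q) = y by rewrite last_cat -last_p -last_q.
case/lastP E: (p ++ q) => [|r z].
  by move: E last_p; case: p {path_p}.
by rewrite last_rcons => -> /(@acyclic_e (y :: r)).
Qed.

Lemma edge_gle x y : e x y -> gle e x y = false.
Proof.
by move=> exy; apply/negP=> /gle_anti/(_ (gle_edge exy)) E; rewrite E edge_irrefl in exy.
Qed.

(** Strictly increasing along the order, hence the induction measure for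
    recursions along edges; it also sorts the vertices topologically. *)
Definition height x := #|[set y | gle e y x]|.

Lemma height_lt x y : gle e x y -> x != y -> height x < height y.
Proof.
move=> xy neq; apply: proper_card; apply/properP; split.
  by apply/subsetP=> z; rewrite !inE => zx; apply: gle_trans xy.
exists y; rewrite !inE ?gle_refl //.
by apply: contra neq => yx; apply/eqP; apply: gle_anti.
Qed.

Lemma height_edge x y : e x y -> height y < height x.
Proof.
move=> exy; apply: height_lt (gle_edge exy) _.
by apply: contraTneq exy => ->; rewrite edge_irrefl.
Qed.

Lemma acyclic_converse : acyclic (converse e).
Proof.
move=> c cyc; apply: size0nil; rewrite -size_rev.
by rewrite (acyclic_e (c := rev c)) // rev_cycle.
Qed.

Lemma linear_extension_exists : exists l, linear_extension e l.
Proof.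
exists (sort (fun x y => height x <= height y) (enum T)).
split; first by rewrite perm_sort.
move=> x y exy; rewrite ltnNge; apply/negP => le_xy.
have := height_edge exy; rewrite ltnNge => /negP; apply.
have tr: transitive (fun a b => height a <= height b).
  by move=> a b c; apply: leq_trans.
apply: (sorted_leq_index tr _ _ _ _ _ _ le_xy); rewrite ?mem_sort ?mem_enum //.
by apply: sort_sorted => a b; apply: leq_total.
Qed.

End Order.

Lemma reverse_linear_extension_exists (T : finType) (e : rel T) :
  acyclic e -> exists l, reverse_linear_extension e l.
Proof.
move=> /acyclic_converse/linear_extension_exists[l [perm_l lt_l]].
by exists l; split=> // x y; apply: lt_l.
Qed.

(** * Complete pairs *)

Section CompletePairs.

Variables (T : finType) (e : rel T).
Implicit Types (A B D U : {set T}) (P Q : {set T} * {set T}).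

Lemma no_edgeP A B : reflect {in A & B, forall x y, ~~ e x y} (no_edge e A B).
Proof.
apply: (iffP forall_inP) => [H x y xA yB | H x xA].
  by have /forall_inP/(_ y yB) := H x xA.
by apply/forall_inP=> y yB; apply: H.
Qed.

Lemma orthogonalP D U :
  reflect [/\ {in D &, forall x y, ~~ e x y}, {in U &, forall x y, ~~ e x y},
              {in D, forall x, x \notin U} & {in D & U, forall x y, ~~ e x y}]
          (orthogonal e D U).
Proof.
apply: (iffP and4P) => -[/no_edgeP iD /no_edgeP iU dj /no_edgeP ne]; split=> //.
  by move=> x xD; rewrite (disjointFr dj xD).
by rewrite disjoint_subset; apply/subsetP=> x /dj; rewrite inE.
Qed.

(** The condition that the greedy constructions of the two sets from each other
    really produce. It implies tightness but does not follow from it: tightness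
    only tests the replacement of a single element. For vertices k, d1, d2, u1,
    u2 with edges from k to d1, d2 and from u1, u2 to k, the pair
    ({d1, d2}, {u1, u2}) is tight, although k could be put into either set once
    two elements of that set are removed. *)
Definition complete P : Prop :=
  orthogonal e P.1 P.2 /\
  forall k, k \notin P.1 -> k \notin P.2 ->
    (exists2 d, d \in P.1 & e d k) \/ (exists2 u, u \in P.2 & e k u).

(** A description of Q as the flip of P at a vertex g of the second set that
    mentions no linear extension and is invariant under reversing all edges,
    swapping the two sets of each pair and exchanging P and Q, which makes every statement about flips dualizable. *)
Definition exchange g P Q : Prop :=
  [/\ g \in P.2, g \in Q.1, forall x, ~~ gle e x g -> (x \in Q.1) = (x \in P.1)
    & forall x, ~~ gle e g x -> (x \in Q.2) = (x \in P.2)].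

Definition up_step P Q : Prop :=
  [/\ complete P, complete Q & exists g, exchange g P Q].

(** The order of the independence poset, transported to bare pairs of sets. *)
Definition pair_le P Q : Prop := clos_refl_trans _ up_step P Q.

Definition upclosed A : Prop := forall x y, gle e x y -> x \in A -> y \in A.

End CompletePairs.

(** Together with [converse], the duality of the whole theory: it reverses
    [pair_le]. *)
Definition swap (T : finType) (P : {set T} * {set T}) := (P.2, P.1).

Lemma swap_inj (T : finType) : injective (@swap T).
Proof. by move=> [D U] [D' U'] [-> ->]. Qed.

Lemma swapK (T : finType) : involutive (@swap T).
Proof. by case. Qed.

Lemma orthogonal_converse (T : finType) (e : rel T) D U :
  orthogonal (converse e) U D = orthogonal e D U.
Proof.
suff imp (r : rel T) A B : orthogonal r A B -> orthogonal (converse r) B A.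
  by apply/idP/idP; exact: imp.
case/orthogonalP=> iA iB dj ne; apply/orthogonalP; split.
- by move=> x y xB yB; apply: iB.
- by move=> x y xA yA; apply: iA.
- by move=> x xB; apply: contraL xB; apply: dj.
- by move=> x y xB yA; apply: ne.
Qed.

Lemma complete_converse (T : finType) (e : rel T) P :
  complete e P -> complete (converse e) (swap P).
Proof.
case=> ort cov; split; first by rewrite orthogonal_converse.
by move=> k kU kD; case: (cov k kD kU) => -[d]; [right|left]; exists d.
Qed.

Lemma exchange_converse (T : finType) (e : rel T) g P Q :
  exchange e g P Q -> exchange (converse e) g (swap Q) (swap P).
Proof.
case=> gP gQ eD eU; split=> // x; rewrite gle_converse /= => nx.
  by rewrite eU.
by rewrite eD.
Qed.

Lemma up_step_converse (T : finType) (e : rel T) P Q :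
  up_step e P Q -> up_step (converse e) (swap Q) (swap P).
Proof.
case=> cP cQ [g x]; split; try exact: complete_converse.
by exists g; apply: exchange_converse.
Qed.

Lemma pair_le_converse (T : finType) (e : rel T) P Q :
  pair_le e P Q -> pair_le (converse e) (swap Q) (swap P).
Proof.
elim=> [X Y XY|X|X Y Z _ IH1 _ IH2].
- by apply: rt_step; apply: up_step_converse.
- exact: rt_refl.
- exact: rt_trans IH2 IH1.
Qed.

Lemma no_edge_converse (T : finType) (e : rel T) A B :
  no_edge (converse e) A B = no_edge e B A.
Proof. by apply/no_edgeP/no_edgeP => ne x y xA yB; apply: ne. Qed.

Lemma complete_up_converse (T : finType) (e : rel T) D U s :
  complete_up e D U s = complete_down (converse e) D U s.
Proof.
by elim: s U => //= k s IHs U; rewrite IHs !(@no_edge_converse _ e).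
Qed.

(** * Greedy completion *)

Section Greedy.

Variables (T : finType) (e : rel T).
Implicit Types (A B D U : {set T}) (s : seq T).

Lemma complete_down_sub U D s :
  D \subset complete_down e U D s /\
  forall x, x \in complete_down e U D s -> (x \in D) || (x \in s).
Proof.
elim: s D => [|k s IHs] D /=; first by split=> // x ->.
set D' := (if _ then _ else _); have [sub inv] := IHs D'.
have DD' : D \subset D' by rewrite /D'; case: ifP => // _; apply: subsetU1.
split; first exact: subset_trans DD' sub.
move=> x /inv/orP[|]; last by rewrite inE => ->; rewrite !orbT.
rewrite /D' inE; case: ifP => _; last by move->.
by rewrite in_setU1 => /orP[->|->]; rewrite ?orbT.
Qed.

(** The greedy set satisfies its defining recursion in final form: the order
    of processing ensures that a vertex added later has no edge to one added
    before, so the test against the current set is also the test against the final set. *)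
Lemma complete_downE U D s :
  (forall x, ~~ e x x) -> pairwise (fun x y => ~~ e y x) s ->
  forall x, (x \in complete_down e U D s) =
    (x \in D) || [&& x \in s, x \notin U, no_edge e [set x] U
                   & no_edge e (complete_down e U D s) [set x]].
Proof.
move=> irr; elim: s D => [|k s IHs] D /=; first by move=> _ x; rewrite ?in_nil ?orbF.
case/andP=> /allP no_back pw x.
set cond := [&& _, _ & _]; set D' := (if _ then _ else _).
have [sub inv] := complete_down_sub U D' s.
rewrite {1}(IHs D' pw x); set C := complete_down e U D' s in sub inv *.
have DE y : (y \in D') = (y \in D) || (y == k) && cond.
  by rewrite /D'; case: ifP => _; rewrite ?in_setU1 ?andbT ?andbF ?orbF // orbC.
have condE: cond = [&& k \notin U, no_edge e [set k] U & no_edge e C [set k]].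
  rewrite /cond; congr [&& _, _ & _]; apply/no_edgeP/no_edgeP => ne y z yD /set1P->.
    have /orP[|ys] := inv y yD; last exact: no_back.
    by rewrite DE => /orP[yD0|/andP[/eqP-> _] //]; apply: ne; rewrite ?set11.
  by apply: ne; rewrite ?set11 // (subsetP sub) // DE yD.
rewrite DE inE; case: eqP => [->|_] /=; last by rewrite orbF.
by rewrite condE; case: (k \in D); case: (k \in s); rewrite ?orbF ?orbT ?orbb.
Qed.

Lemma pairwise_reverse_linear_extension s :
  reverse_linear_extension e s -> pairwise (fun x y => ~~ e y x) s.
Proof.
case=> perm_s lt_s; have uniq_s : uniq s by rewrite (perm_uniq perm_s) enum_uniq.
case E: s => [//|x0 s']; rewrite -E; apply/(pairwiseP x0) => i j.
rewrite !inE => ltis ltjs ltij; apply/negP => /lt_s.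
by rewrite !index_uniq // ltnNge (ltnW ltij).
Qed.

Lemma reverse_linear_extension_mem s :
  reverse_linear_extension e s -> forall x, x \in s.
Proof. by case=> perm_s _ x; rewrite (perm_mem perm_s) mem_enum. Qed.

End Greedy.

Lemma linear_extension_converse (T : finType) (e : rel T) s :
  linear_extension e s -> reverse_linear_extension (converse e) s.
Proof. by case=> perm_s lt_s; split=> // x y; apply: lt_s. Qed.

(** * A complete pair is determined by either of its sets *)

Section CompletePairsTheory.

Variables (T : finType) (e : rel T).
Hypothesis acyclic_e : acyclic e.
Implicit Types (A B D U : {set T}) (P Q : {set T} * {set T}).

Lemma complete_disjoint P x : complete e P -> x \in P.1 -> x \notin P.2.
Proof. by case=> /orthogonalP[_ _ dj _] _; apply: dj. Qed.

Lemma complete_disjointr P x : complete e P -> x \in P.2 -> x \notin P.1.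
Proof. by move=> cP; apply: contraL; apply: complete_disjoint. Qed.

Lemma complete_no_edge P x y : complete e P -> x \in P.1 -> y \in P.2 -> ~~ e x y.
Proof. by case=> /orthogonalP[_ _ _ ne] _; apply: ne. Qed.

(** In the region A, membership of k in the second set depends only on the first
    set and on the membership of the out-neighbours of k, so it is determined by
    recursion along the edges. *)
Lemma up_determined A P Q : upclosed e A -> complete e P -> complete e Q ->
  {in A, forall x, (x \in P.1) = (x \in Q.1)} ->
  P.2 \subset A -> Q.2 \subset A -> P.2 = Q.2.
Proof.
move=> upA cP cQ eD sP sQ.
suff imp n : forall P Q, complete e P -> complete e Q ->
    {in A, forall x, (x \in P.1) = (x \in Q.1)} -> P.2 \subset A -> Q.2 \subset A ->
    forall k, height e k < n -> k \in P.2 -> k \in Q.2.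
  apply/setP=> k; apply/idP/idP; apply: imp (ltnSn _) => //.
  by move=> x xA; rewrite eD.
move=> {P Q cP cQ eD sP sQ}; elim: n => // n IHn P Q cP cQ eD sP sQ k ltk kP.
have kA := subsetP sP k kP.
have [/orthogonalP[_ iP djP neP] _] := cP.
have [_ covQ] := cQ.
have kQ : k \notin Q.1 by rewrite -eD //; apply: contraL kP; apply: djP.
apply: contraT => kQ2; case: (covQ k kQ kQ2) => -[y yQ eyk].
  have yA : y \in A by apply: upA (gle_edge eyk) kA.
  by have := neP y k; rewrite eD // eyk => /(_ yQ kP).
have yP : y \in P.2.
  apply: (IHn Q P) yQ => //; first by move=> x xA; rewrite eD.
  by apply: leq_trans (height_edge acyclic_e eyk) _; rewrite -ltnS.
by have := iP k y kP yP; rewrite eyk.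
Qed.

End CompletePairsTheory.

Section Determination.

Variables (T : finType) (e : rel T).
Hypothesis acyclic_e : acyclic e.
Implicit Types (A B D U : {set T}) (P Q : {set T} * {set T}).

(** Once the second sets agree, the dual of [up_determined] recovers the first
    sets outside A as well. *)
Lemma complete_eq A P Q : upclosed e A -> complete e P -> complete e Q ->
  {in A, forall x, (x \in P.1) = (x \in Q.1)} ->
  P.2 \subset A -> Q.2 \subset A -> P = Q.
Proof.
move=> upA cP cQ eD sP sQ; have eU := up_determined acyclic_e upA cP cQ eD sP sQ.
rewrite [P]surjective_pairing [Q]surjective_pairing eU; congr (_, _).
apply: (up_determined (acyclic_converse acyclic_e)
  (A := setT) (P := swap P) (Q := swap Q)).
- by move=> x y _ _; rewrite inE.
- exact: complete_converse.
- exact: complete_converse.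
- by move=> x _; rewrite /= eU.
- exact: subsetT.
- exact: subsetT.
Qed.

Lemma complete_eq_down P Q : complete e P -> complete e Q -> P.1 = Q.1 -> P = Q.
Proof.
by move=> cP cQ eD; apply: (complete_eq (A := setT)); rewrite ?subsetT ?eD.
Qed.

End Determination.

Lemma complete_eq_up (T : finType) (e : rel T) (acyclic_e : acyclic e) P Q :
  complete e P -> complete e Q -> P.2 = Q.2 -> P = Q.
Proof.
move=> cP cQ eU; apply: swap_inj.
by apply: (complete_eq_down (acyclic_converse acyclic_e)) => //; apply: complete_converse.
Qed.

(** * Flips *)

Section Flips.

Variables (T : finType) (e : rel T).
Hypothesis acyclic_e : acyclic e.
Implicit Types (A B D U : {set T}) (P Q : {set T} * {set T}).

(** The first set of the result is known off the down-set of g, and below g it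
    follows by recursion from above, because below g the second set is that of
    P. *)
Lemma exchange_unique g P Q Q' :
  complete e Q -> complete e Q' -> exchange e g P Q -> exchange e g P Q' -> Q = Q'.
Proof.
suff imp n : forall Q Q', complete e Q -> complete e Q' ->
    exchange e g P Q -> exchange e g P Q' ->
    forall k, height (converse e) k < n -> k \in Q.1 -> k \in Q'.1.
  move=> cQ cQ' xQ xQ'; apply: (complete_eq_down acyclic_e) => //.
  by apply/setP=> x; apply/idP/idP; apply: imp (ltnSn _).
elim: n => // n IHn {}Q {}Q' cQ cQ' xQ xQ' k ltk kQ.
have [_ gQ eD eU] := xQ; have [_ gQ' eD' eU'] := xQ'.
have [/orthogonalP[iQ _ djQ neQ] _] := cQ.
have [_ covQ'] := cQ'.
have [kg|kg] := boolP (gle e k g); last by rewrite eD' // -eD.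
have [->//|neq] := eqVneq k g.
have gk : ~~ gle e g k.
  by apply: contra neq => gk; apply/eqP; apply: gle_anti acyclic_e _ _ kg gk.
apply: contraT => kD'; have kU' : k \notin Q'.2 by rewrite eU' // -eU //; apply: djQ.
case: (covQ' k kD' kU') => -[y yQ' eyk].
  suff yQ : y \in Q.1 by have := iQ y k yQ kQ; rewrite eyk.
  apply: (IHn Q' Q) => //.
  rewrite ltnS in ltk; apply: leq_trans ltk.
  exact: (height_edge (acyclic_converse acyclic_e)).
have gy : ~~ gle e g y.
  by apply: contra gk => gy; apply: gle_trans gy (gle_edge eyk).
by have := neQ k y kQ; rewrite eU // -eU' // eyk => /(_ yQ').
Qed.

(** The pair of sets from which the greedy phases of a flip at g start. *)
Definition flip_seed_down g P := g |: [set k in P.1 | ~~ gle e k g].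
Definition flip_seed_up g P := [set k in P.2 | ~~ gle e g k].

Lemma flipE l l' g P : linear_extension e l -> reverse_linear_extension e l' ->
    g \in P.2 -> g \notin P.1 ->
    let Q := flip e l l' g P in
    (forall x, (x \in Q.1) = (x \in flip_seed_down g P) ||
       [&& ~~ gle e g x, x \notin flip_seed_up g P, no_edge e [set x] (flip_seed_up g P)
         & no_edge e Q.1 [set x]]) /\
    (forall x, (x \in Q.2) = (x \in flip_seed_up g P) ||
       [&& ~~ gle e x g, x \notin Q.1, no_edge e Q.1 [set x]
         & no_edge e [set x] Q.2]).
Proof.
move=> lin rlin; case: P => D U /= gU gD.
rewrite /flip in_setU gU orbT /= (negbTE gD).
split=> x.
  rewrite {1}complete_downE.
  - by rewrite mem_filter (reverse_linear_extension_mem rlin) andbT.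
  - by move=> y; rewrite edge_irrefl.
  - exact/pairwise_filter/pairwise_reverse_linear_extension.
rewrite complete_up_converse {1}complete_downE.
- by rewrite mem_filter (reverse_linear_extension_mem (linear_extension_converse lin)) andbT
     ?(@no_edge_converse _ e).
- by move=> y; rewrite edge_irrefl //; apply: acyclic_converse.
- exact/pairwise_filter/pairwise_reverse_linear_extension/linear_extension_converse.
Qed.

Lemma not_no_edge_from k A : ~~ no_edge e [set k] A -> exists2 u, u \in A & e k u.
Proof.
move=> ne; apply/exists_inP; apply: contraR ne => /exists_inPn none.
by apply/no_edgeP=> x y /set1P-> /none.
Qed.

Lemma not_no_edge_to k A : ~~ no_edge e A [set k] -> exists2 d, d \in A & e d k.
Proof.
move=> ne; apply/exists_inP; apply: contraR ne => /exists_inPn none.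
by apply/no_edgeP=> x y xA /set1P->; apply: none.
Qed.

(** Every vertex is tested in one of the two greedy phases, and a failed test is
    what completeness asks for. This applies in particular to flips of incomplete
    tops. *)
Lemma flip_complete l l' g P :
  linear_extension e l -> reverse_linear_extension e l' -> g \in P.2 -> g \notin P.1 ->
  orthogonal e (flip e l l' g P).1 (flip e l l' g P).2 -> complete e (flip e l l' g P).
Proof.
move=> lin rlin gU gD ort; split=> // k kD kU.
have [/(_ k) DE /(_ k) UE] := flipE lin rlin gU gD.
move: UE DE kD kU; set Q := flip e l l' g P.
have [kg|kg] := boolP (gle e k g).
  have [->|neq] := eqVneq k g.
    by move=> _ -> /negP[]; rewrite inE set11.
  have -> /= : ~~ gle e g k.
    by apply: contra neq => gk; apply/eqP; apply: gle_anti gk.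
  rewrite orbF => -> -> /norP[_]; rewrite !negb_and negbK.
  case/or3P=> [->//|/not_no_edge_from[u uU0 eku] _|/not_no_edge_to ? _]; last by left.
  right; exists u => //; have [_ /(_ u)] := flipE lin rlin gU gD.
  by rewrite uU0.
move=> -> _ kD /norP[_]; rewrite kD /= negb_and.
by case/orP=> [/not_no_edge_to|/not_no_edge_from]; [left|right].
Qed.

(** A vertex that enters the first set while not below g would already have been
    addable to P, against its completeness; likewise a vertex that enters the
    second set lies above g. This locality gives both the orthogonality of the
    result and its agreement with P away from g. *)
Lemma flip_exchange l l' g P :
  linear_extension e l -> reverse_linear_extension e l' -> complete e P -> g \in P.2 ->
  complete e (flip e l l' g P) /\ exchange e g P (flip e l l' g P).
Proof.
move=> lin rlin cP gU.
have [/orthogonalP[iD iU dj ne] cov] := cP.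
have gD : g \notin P.1 by apply: contraL gU; apply: dj.
have [DE UE] := flipE lin rlin gU gD.
have flipc := flip_complete lin rlin gU gD.
move: DE UE flipc; set Q := flip e l l' g P.
set D0 := flip_seed_down g P; set U0 := flip_seed_up g P => DE UE flipc.
have D0E x : x \in D0 = (x == g) || (x \in P.1) && ~~ gle e x g by rewrite !inE.
have U0E x : x \in U0 = (x \in P.2) && ~~ gle e g x by rewrite inE.
have subD x : x \in D0 -> x \in Q.1 by rewrite DE => ->.
have subU x : x \in U0 -> x \in Q.2 by rewrite UE => ->.
have gQ : g \in Q.1 by rewrite subD // D0E eqxx.
have newD x : x \in Q.1 -> x \notin D0 ->
    [/\ gle e x g, ~~ gle e g x, x \notin U0, {in U0, forall u, ~~ e x u}
      & {in Q.1, forall d, ~~ e d x}].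
  rewrite DE => /orP[->//|/and4P[gx xU0 /no_edgeP xU /no_edgeP dx]] xD0.
  have {}xU : {in U0, forall u, ~~ e x u} by move=> u; apply: xU; rewrite set11.
  have {}dx : {in Q.1, forall d, ~~ e d x} by move=> u uQ; apply: dx; rewrite ?set11.
  split=> //; apply: contraT => xg.
  have xP : x \notin P.1.
    by apply: contra xD0 => xP; rewrite D0E xP xg orbT.
  have xP2 : x \notin P.2.
    by apply: contra xU0 => xP2; rewrite U0E xP2 gx.
  case: (cov x xP xP2) => -[y yP exy].
    have yg : ~~ gle e y g.
      by apply: contra xg => yg; apply: gle_trans yg; apply: gle_edge.
    by have := dx y; rewrite subD ?exy ?D0E ?yP ?yg ?orbT // => /(_ isT).
  have gy : ~~ gle e g y.
    by apply: contra gx => gy; apply: gle_trans gy (gle_edge exy).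
  by have := xU y; rewrite U0E yP gy exy => /(_ isT).
have newU x : x \in Q.2 -> x \notin U0 ->
    [/\ gle e g x, ~~ gle e x g, x \notin Q.1, {in Q.1, forall d, ~~ e d x}
      & {in Q.2, forall u, ~~ e x u}].
  rewrite UE => /orP[->//|/and4P[gx xQ1 /no_edgeP dx /no_edgeP xU]] xU0.
  have {}xU : {in Q.2, forall u, ~~ e x u} by move=> u; apply: xU; rewrite set11.
  have {}dx : {in Q.1, forall d, ~~ e d x} by move=> u uQ; apply: dx; rewrite ?set11.
  split=> //; apply: contraT => xg; case/negP: (xQ1).
  rewrite DE xg xU0 /=; apply/orP; right; apply/andP; split; apply/no_edgeP => a b.
    by move=> /set1P-> bU; apply: xU; apply: subU.
  by move=> aQ /set1P->; apply: dx.
have exch : exchange e g P Q.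
  split=> // x xg.
    apply/idP/idP => [xQ|xP]; last by rewrite subD // D0E xP xg orbT.
    have [xD0|/(newD _ xQ)[]] := boolP (x \in D0); last by rewrite (negbTE xg).
    move: xD0; rewrite D0E => /predU1P[xe|/andP[]//].
    by rewrite xe gle_refl in xg.
  apply/idP/idP => [xQ|xP]; last by rewrite subU // U0E xP xg.
  have [xU0|/(newU _ xQ)[]] := boolP (x \in U0); last by rewrite (negbTE xg).
  by move: xU0; rewrite U0E => /andP[].
split=> //; apply: flipc; apply/orthogonalP.
have D0U0 x y : x \in D0 -> y \in U0 -> ~~ e x y.
  rewrite D0E U0E => /predU1P[->|/andP[xP _]] /andP[yP _]; [exact: iU|exact: ne].
split.
- move=> x y xQ yQ.
  have [yD0|/(newD y yQ)[_ _ _ _ ->//]] := boolP (y \in D0).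
  have [xD0|/(newD x xQ)[xg gx _ _ _]] := boolP (x \in D0).
    move: xD0 yD0; rewrite !D0E => /predU1P[->|/andP[xP xg]] /predU1P[->|/andP[yP yg]].
    + by rewrite edge_irrefl.
    + by apply: contra yg => /gle_edge.
    + exact: ne.
    + exact: iD.
  apply/negP=> exy; move: yD0; rewrite D0E => /predU1P[yg|/andP[_ /negP[]]].
    by rewrite -yg gle_edge in gx.
  by apply: gle_trans xg; apply: gle_edge.
- move=> x y xQ yQ.
  have [xU0|/(newU x xQ)[_ _ _ _ ->//]] := boolP (x \in U0).
  have [yU0|/(newU y yQ)[gy _ _ _ _]] := boolP (y \in U0).
    by apply: iU; [move: xU0|move: yU0]; rewrite U0E => /andP[].
  move: xU0; rewrite U0E => /andP[_]; apply: contra => exy.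
  by apply: gle_trans gy _; apply: gle_edge.
- move=> x xQ; apply/negP => xQ2.
  have [xU0|/(newU x xQ2)[_ _ /negP[]//]] := boolP (x \in U0).
  have [xD0|/(newD x xQ)[_ _ /negP[]//]] := boolP (x \in D0).
  move: xD0 xU0; rewrite D0E U0E => /predU1P[->|/andP[xP _]] /andP[xP2].
    by rewrite gle_refl.
  by rewrite (negbTE (dj x xP)) in xP2.
- move=> x y xQ yQ.
  have [yU0|/(newU y yQ)[_ _ _ -> //]] := boolP (y \in U0).
  have [xD0|/(newD x xQ)[_ _ _ -> //]] := boolP (x \in D0).
  exact: D0U0.
Qed.

Lemma flip_up_exists g P : complete e P -> g \in P.2 ->
  exists2 Q, complete e Q & exchange e g P Q.
Proof.
move=> cP gP; have [l lin] := linear_extension_exists acyclic_e.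
have [l' rlin] := reverse_linear_extension_exists acyclic_e.
by have [cQ xQ] := flip_exchange lin rlin cP gP; exists (flip e l l' g P).
Qed.

(** The second set is the kernel of the subgraph of vertices outside D that
    receive no edge from D. *)
Lemma independent_complete D : {in D &, forall x y, ~~ e x y} ->
  exists2 P, complete e P & P.1 = D.
Proof.
move=> iD; have [l lin] := linear_extension_exists acyclic_e.
exists (D, complete_up e D set0 l) => //.
have UE x : x \in complete_up e D set0 l = [&& x \notin D, no_edge e D [set x]
       & no_edge e [set x] (complete_up e D set0 l)].
  rewrite complete_up_converse {1}complete_downE.
  - by rewrite (reverse_linear_extension_mem (linear_extension_converse lin)) inE
       ?(@no_edge_converse _ e).
  - by move=> y; rewrite edge_irrefl //; apply: acyclic_converse.
  - exact/pairwise_reverse_linear_extension/linear_extension_converse.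
split=> [|k /= kD].
  apply/orthogonalP; split=> //= x.
  - by move=> y; rewrite {1}UE => /and3P[_ _ /no_edgeP xU] yU; apply: xU; rewrite ?set11.
  - by move=> xD; rewrite UE xD.
  - by move=> y xD; rewrite UE => /and3P[_ /no_edgeP Dy _]; apply: Dy; rewrite ?set11.
rewrite UE kD /= negb_and.
by case/orP=> [/not_no_edge_to|/not_no_edge_from]; [left|right].
Qed.

End Flips.

(** * A measure that increases along flips *)

Section Weight.

Variables (T : finType) (e : rel T).
Hypothesis acyclic_e : acyclic e.
Implicit Types (A B D U : {set T}) (P Q : {set T} * {set T}).

(** The powers make a vertex of A heavier than all vertices strictly below it
    together, so gaining g outweighs losing anything below g. The restriction to A
    is needed for regions in which the second set is confined to A. *)
Definition weight A P := \sum_(d in P.1 :&: A) #|T|.+1 ^ height e d.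

Lemma weight_lt A g P Q : g \notin P.1 -> g \in A -> exchange e g P Q ->
  weight A P < weight A Q.
Proof.
move=> gP gA [_ gQ eD _].
rewrite /weight (bigID [pred d | gle e d g]) [X in _ < X](bigID [pred d | gle e d g]) /=.
set restP := (X in _ + X < _); set restQ := (X in _ < _ + X).
have -> : restP = restQ.
  apply: eq_bigl => d; rewrite !inE.
  by have [|/eD->] := boolP (gle e d g); rewrite ?andbF.
rewrite ltn_add2r [X in _ < X](bigD1 g) /=; last by rewrite in_setI gQ gA gle_refl.
apply: leq_trans (leq_addr _ _).
have h0 : 0 < height e g by apply/card_gt0P; exists g; rewrite inE gle_refl.
apply: (@leq_ltn_trans (\sum_(d | (d \in P.1 :&: A) && gle e d g)
                          #|T|.+1 ^ (height e g).-1)).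
  apply: leq_sum => d /andP[]; rewrite inE => /andP[dP _] dg.
  apply: leq_pexp2l => //; rewrite -ltnS prednK //.
  by apply: height_lt dg _ => //; apply: contraNneq gP => <-.
rewrite sum_nat_const -[X in _ < _ ^ X](prednK h0) expnS ltn_pmul2r ?expn_gt0 //.
by rewrite ltnS max_card.
Qed.

(** If nothing of A lies strictly below g, a flip at g loses nothing in A, so the
    gain in weight is the same for all pairs. *)
Lemma weight_minimal A g P Q : g \notin P.1 -> g \in A ->
  {in A, forall x, gle e x g -> x = g} -> exchange e g P Q ->
  weight A Q = #|T|.+1 ^ height e g + weight A P.
Proof.
move=> gP gA ming [_ gQ eD _]; rewrite /weight (bigD1 g) /=; last by rewrite inE gQ.
congr (_ + _); apply: eq_bigl => x; rewrite !inE.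
have [xA|] := boolP (x \in A); last by rewrite !andbF.
have [->|neq] := eqVneq x g; first by rewrite (negbTE gP) andbF.
by rewrite !andbT eD //; apply: contra neq => /(ming x xA)->.
Qed.

Lemma up_step_weight P Q : up_step e P Q -> weight setT P < weight setT Q.
Proof.
case=> cP _ [g xg]; apply: weight_lt (xg); rewrite ?inE //.
by case: xg => gP _ _ _; apply: complete_disjointr cP gP.
Qed.

Lemma weight_max P : weight setT P <= \sum_d #|T|.+1 ^ height e d.
Proof.
rewrite [X in _ <= X](bigID [pred d | d \in P.1 :&: setT]) /=; exact: leq_addr.
Qed.

(** Weights are bounded, so every ascending sequence of flips stops. *)
Lemma up_step_ind (I : {set T} * {set T} -> Prop) :
  (forall P, complete e P -> (forall Q, up_step e P Q -> I Q) -> I P) ->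
  forall P, complete e P -> I P.
Proof.
move=> step P; have [n] := ubnP (\sum_d #|T|.+1 ^ height e d - weight setT P).
elim: n P => // n IHn P ltn cP; apply: step => // Q PQ; apply: IHn; last by case: PQ.
apply: leq_trans (ltn_sub2l _ (up_step_weight PQ)) _; last by rewrite -ltnS.
exact: leq_trans (up_step_weight PQ) (weight_max Q).
Qed.

Lemma pair_le_inv (I : {set T} * {set T} -> Prop) P Q :
  (forall X Y, up_step e X Y -> I X -> I Y) -> pair_le e P Q -> I P -> I Q.
Proof. by move=> step; elim=> // X Y Z _ IH1 _ IH2 /IH1. Qed.

Lemma pair_le_complete P Q : pair_le e P Q -> complete e P -> complete e Q.
Proof. by apply: pair_le_inv => X Y []. Qed.

(** The second set only gains vertices above one of its elements, hence stays in
    an up-closed set. *)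
Lemma up_step_region A P Q : upclosed e A -> up_step e P Q -> P.2 \subset A ->
  Q.2 \subset A /\ weight A P < weight A Q.
Proof.
move=> upA [cP cQ [g xg]] sP; have [gP gQ _ eU] := xg.
have gA := subsetP sP g gP; split; last first.
  by apply: weight_lt gA xg; apply: complete_disjointr cP gP.
apply/subsetP=> x xQ; have [gx|gx] := boolP (gle e g x); first exact: upA gA.
by apply: (subsetP sP); rewrite -eU.
Qed.

Lemma pair_le_region A P Q : upclosed e A -> pair_le e P Q -> P.2 \subset A ->
  Q.2 \subset A /\ (P = Q \/ weight A P < weight A Q).
Proof.
move=> upA; elim=> {P Q} [P Q PQ sP|P sP|P Q R _ IH1 _ IH2 sP].
- by have [sQ lt] := up_step_region upA PQ sP; split=> //; right.
- by split=> //; left.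
- have [sQ PQ] := IH1 sP; have [sR QR] := IH2 sQ; split=> //.
  case: PQ QR => [->//|ltPQ] [<-|ltQR]; right=> //; exact: ltn_trans ltQR.
Qed.

Lemma pair_le_weight A P Q : upclosed e A -> pair_le e P Q -> P.2 \subset A ->
  weight A P <= weight A Q.
Proof. by move=> upA PQ /(pair_le_region upA PQ)[_ [->|/ltnW]]. Qed.

Lemma pair_le_refl P : pair_le e P P.
Proof. exact: rt_refl. Qed.

Lemma pair_le_trans Q P R : pair_le e P Q -> pair_le e Q R -> pair_le e P R.
Proof. exact: rt_trans. Qed.

Lemma pair_le_step P Q : up_step e P Q -> pair_le e P Q.
Proof. exact: rt_step. Qed.

(** Climbing from P, the second set can be reduced to {k}: flipping any vertex
    u <> k of it preserves the hypothesis on k unless k is strictly below u; if all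
    of them are above k, completeness puts k into the second set, where it protects
    itself by orthogonality. *)
Lemma le_meet_irr P M k : complete e P -> complete e M -> M.2 = [set k] ->
  k \notin P.1 -> {in P.1, forall d, ~~ e d k} -> pair_le e P M.
Proof.
move=> + cM M2; elim/up_step_ind: P / => P cP IH kP dk.
have [P2|neq] := eqVneq P.2 [set k].
  by rewrite (complete_eq_up acyclic_e cP cM) ?M2 //; apply: pair_le_refl.
have [u uP /andP[neq_uk uk]] :
    exists2 u, u \in P.2 & (u != k) && (~~ gle e k u || (k \in P.2)).
  apply/exists_inP; have [kP2|kP2] := boolP (k \in P.2).
    apply: contraR neq => /exists_inPn only_k; rewrite eqEsubset sub1set kP2 andbT.
    apply/subsetP=> u /only_k; rewrite inE orbT andbT negbK //.
  case: (cP) => _ /(_ k kP kP2)[[d /dk/negP]//|[u uP eku]].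
  apply/exists_inP; exists u => //; rewrite (edge_gle acyclic_e eku) andbT.
  by apply: contraTneq eku => ->; rewrite edge_irrefl.
have [Q cQ xQ] := flip_up_exists acyclic_e cP uP.
have PQ : up_step e P Q by split=> //; exists u.
apply: pair_le_trans (pair_le_step PQ) _.
have [_ uQ eD eU] := xQ.
have [ku|ku] := boolP (gle e k u); last first.
  apply: IH => //; first by rewrite eD.
  move=> d dQ; apply/negP => edk.
  have du : ~~ gle e d u by apply: contra ku; apply: gle_trans; apply: gle_edge.
  by have := dk d; rewrite -eD // edk => /(_ dQ).
have kQ : k \in Q.2.
  rewrite ku /= in uk; rewrite eU //.
  by apply: contra neq_uk => uk'; apply/eqP; apply: gle_anti acyclic_e _ _ uk' ku.
apply: IH => //; first exact: complete_disjointr cQ kQ.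
by move=> d dQ; apply: complete_no_edge cQ dQ kQ.
Qed.

End Weight.

(** * Comparison with join- and meet-irreducibles in a lattice of pairs *)

Section Lattice.

Variables (T : finType) (e : rel T).
Hypothesis acyclic_e : acyclic e.
Implicit Types (A B D U : {set T}) (P Q : {set T} * {set T}).

Lemma join_irr_le P J g : complete e P -> complete e J -> J.1 = [set g] ->
  g \notin P.2 -> {in P.2, forall u, ~~ e g u} -> pair_le e J P.
Proof.
move=> cP cJ J1 gP gu; rewrite -(swapK J) -(swapK P).
apply: (@pair_le_converse _ (converse e) (swap P) (swap J)).
apply: (le_meet_irr (acyclic_converse acyclic_e) (k := g)) => //;
  exact: complete_converse.
Qed.

(** Descending by flips at elements of the first set inside B stays in the region
    of pairs whose second set lies in B, and stops only when the first set avoids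
    B. By [complete_eq] the pair reached does not depend on Q: the region has a
    least element. *)
Lemma region_min B Q : upclosed e B -> complete e Q -> Q.2 \subset B ->
  exists2 Y, complete e Y /\ pair_le e Y Q &
    Y.2 \subset B /\ {in B, forall x, x \notin Y.1}.
Proof.
move=> upB; rewrite -(swapK Q) => /complete_converse; rewrite (swapK (swap Q)).
move: (swap Q) => {}Q.
elim/(@up_step_ind _ _ (acyclic_converse acyclic_e)): Q / => Q cQ IH sQ.
have [none|] := boolP [forall x in B, x \notin Q.2].
  exists (swap Q); last by split=> //; apply/forall_inP.
  by split; [apply: (complete_converse cQ)|apply: pair_le_refl].
rewrite negb_forall_in => /exists_inP[g gB]; rewrite negbK => gQ.
have [R cR xR] := flip_up_exists (acyclic_converse acyclic_e) cQ gQ.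
have QR : up_step (converse e) Q R by split=> //; exists g.
have [|Y [cY YR] HY] := IH R QR.
  apply/subsetP=> x xR1; have [xg|xg] := boolP (gle e g x); first exact: upB gB.
  case: xR => _ _ eD _; rewrite eD in xR1; last by rewrite gle_converse.
  exact: (subsetP sQ).
exists Y => //; split=> //; apply: pair_le_trans YR _.
exact: (pair_le_step (up_step_converse QR)).
Qed.

(** Any ascending path along which u leaves the second set has a step at which
    this happens. *)
Lemma crossing u P W : pair_le e P W ->
  u \in P.2 -> u \notin W.2 ->
  exists X, exists2 Y, [/\ up_step e X Y & u \in X.2 /\ u \notin Y.2] &
    pair_le e P X /\ pair_le e Y W.
Proof.
move/(@clos_rt_rt1n _ _ _ _); elim=> {P W} [P uP /negP//|P Q W PQ QW IH uP uW].
have {}QW : pair_le e Q W by apply: clos_rt1n_rt.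
have [uQ|uQ] := boolP (u \in Q.2); last first.
  by exists P; exists Q => //; split=> //; apply: pair_le_refl.
have [X [Y XY [QX YW]]] := IH uQ uW; exists X; exists Y => //; split=> //.
exact: pair_le_trans (pair_le_step PQ) QX.
Qed.

Definition has_meets := forall P Q, complete e P -> complete e Q ->
  exists Z, [/\ complete e Z, pair_le e Z P, pair_le e Z Q &
    forall W, complete e W -> pair_le e W P -> pair_le e W Q -> pair_le e W Z].

Definition has_joins := forall P Q, complete e P -> complete e Q ->
  exists Z, [/\ complete e Z, pair_le e P Z, pair_le e Q Z &
    forall W, complete e W -> pair_le e P W -> pair_le e Q W -> pair_le e Z W].

(** A flip changes the second set only above the flipped vertex, so a minimal
    vertex u of the region can only leave by a flip at u itself. *)
Lemma up_step_minimal A u X Y : upclosed e A ->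
  {in A, forall x, gle e x u -> x = u} -> up_step e X Y -> X.2 \subset A ->
  u \in X.2 -> u \notin Y.2 -> exchange e u X Y.
Proof.
move=> upA minu [_ _ [g xg]] sX uX uY; have [gX _ _ eU] := xg.
suff <- : g = u by [].
apply: minu; first exact: subsetP gX.
by apply: contraR uY => /eU->.
Qed.

(** A flip at a minimal vertex u of the region is a covering relation. A path from
    P to Q contains exactly one flip at u, and that flip adds the same weight as
    the flip from P to Q; therefore no weight is left for any other step. *)
Lemma flip_minimal_cover A u P Q W : upclosed e A ->
  {in A, forall x, gle e x u -> x = u} -> complete e P -> P.2 \subset A ->
  up_step e P Q -> exchange e u P Q -> pair_le e P W -> pair_le e W Q -> W = P \/ W = Q.
Proof.
move=> upA minu cP sP PQ xQ PW WQ; have [uP uQ _ _] := xQ.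
have uA := subsetP sP u uP.
have [_ cQ _] := PQ.
have [sW _] := pair_le_region acyclic_e upA PW sP.
have cW := pair_le_complete PW cP.
suff crossP X Y : pair_le e P X -> up_step e X Y -> pair_le e Y Q ->
    u \in X.2 -> u \notin Y.2 -> P = X /\ Q = Y.
  have [uW|uW] := boolP (u \in W.2).
    have [X [Y [XY [uX uY]] [WX YQ]]] := crossing WQ uW (complete_disjoint cQ uQ).
    have [PX QY] := crossP X Y (pair_le_trans PW WX) XY YQ uX uY.
    have [_ [->|]] := pair_le_region acyclic_e upA WX sW; first by left.
    by rewrite ltnNge -PX pair_le_weight.
  have [X [Y [XY [uX uY]] [PX YW]]] := crossing PW uP uW.
  have [_ QY] := crossP X Y PX XY (pair_le_trans YW WQ) uX uY.
  have [sX _] := pair_le_region acyclic_e upA PX sP.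
  have [sY _] := pair_le_region acyclic_e upA (pair_le_step XY) sX.
  have [_ [<-|]] := pair_le_region acyclic_e upA YW sY; first by right.
  by rewrite ltnNge -QY pair_le_weight.
move=> PX XY YQ uX uY.
have [sX PXd] := pair_le_region acyclic_e upA PX sP.
have [sY _] := pair_le_region acyclic_e upA (pair_le_step XY) sX.
have [cX cY _] := XY.
have xY := up_step_minimal upA minu XY sX uX uY.
have PX_eq : P = X.
  case: PXd => // ltPX.
  have := pair_le_weight acyclic_e upA YQ sY.
  rewrite (weight_minimal _ uA minu xY) ?(complete_disjointr cX) //.
  rewrite (weight_minimal _ uA minu xQ) ?(complete_disjointr cP) //.
  by rewrite leq_add2l leqNgt ltPX.
split=> //; apply: (exchange_unique acyclic_e cQ cY xQ).
by rewrite PX_eq.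
Qed.

(** The converse of [le_meet_irr], which holds as soon as meets exist. Let A be the
    region generated by k and the second set of P. If k is the only minimal vertex
    of A, then k must already be in the second set of P, as it can never be put
    back later. Otherwise flip P at another minimal vertex u, giving Q. The region
    without u has a least element, which lies below both Q and M; hence the meet of
    Q and M is not P, and by the covering property it is Q. So Q is below M, and
    the induction applies to Q, which agrees with P near k. *)
Lemma le_meet_irr_inv P M k :
  has_meets -> complete e P -> complete e M -> M.2 = [set k] ->
  pair_le e P M -> k \notin P.1 /\ {in P.1, forall d, ~~ e d k}.
Proof.
move=> meets + cM M2; elim/(up_step_ind acyclic_e): P / => P cP IH PM.
pose A := [set x | gle e k x || [exists u in P.2, gle e u x]].
have upA : upclosed e A.
  move=> x y xy; rewrite !inE => /orP[kx|/exists_inP[u uP ux]].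
    by rewrite (gle_trans kx xy).
  by apply/orP; right; apply/exists_inP; exists u => //; apply: gle_trans ux xy.
have sP : P.2 \subset A.
  apply/subsetP=> u uP; rewrite inE; apply/orP; right; apply/exists_inP.
  by exists u => //; apply: gle_refl.
have kA : k \in A by rewrite inE gle_refl.
have [all_above|] := boolP [forall u in P.2, gle e k u].
  have mink : {in A, forall x, gle e x k -> x = k}.
    move=> x; rewrite inE => /orP[kx|/exists_inP[u /(forall_inP all_above) ku ux]] xk;
      apply: gle_anti acyclic_e _ _ xk _ => //; exact: gle_trans ux.
  suff kP : k \in P.2.
    split=> [|d dP]; first exact: complete_disjointr cP kP.
    exact: complete_no_edge cP dP kP.
  apply: contraT => kP.
  suff inv X Y : up_step e X Y -> X.2 \subset A /\ k \notin X.2 ->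
      Y.2 \subset A /\ k \notin Y.2.
    by have [] := pair_le_inv inv PM (conj sP kP); rewrite M2 set11.
  move=> XY [sX kX].
  have [sY _] := up_step_region acyclic_e upA XY sX; split=> //.
  case: XY => _ _ [g [gX _ _ eU]]; rewrite eU //; apply: contra kX => gk.
  by rewrite -(mink g) //; apply: (subsetP sX).
rewrite negb_forall_in => /exists_inP[x0 x0P kx0].
pose low x := (x \in P.2) && ~~ gle e k x.
have low0 : low x0 by rewrite /low x0P.
case: (arg_minnP (height e) low0) => u /andP[uP ku] min_u.
have uA := subsetP sP u uP.
have minu : {in A, forall x, gle e x u -> x = u}.
  move=> x; rewrite inE => /orP[kx|/exists_inP[v vP vx]] xu.
    by rewrite (gle_trans kx xu) in ku.
  have vu := gle_trans vx xu.
  have low_v : low v by rewrite /low vP; apply: contra ku => kv; apply: gle_trans kv vu.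
  have [vu_eq|neq] := eqVneq v u.
    by apply: gle_anti acyclic_e _ _ xu _; rewrite -vu_eq.
  by have := height_lt acyclic_e vu neq; rewrite ltnNge min_u.
have neq_ku : k != u by apply: contraNneq ku => ->; apply: gle_refl.
have [Q cQ xQ] := flip_up_exists acyclic_e cP uP.
have PQ : up_step e P Q by split=> //; exists u.
have [_ uQ eD eU] := xQ.
suff QM : pair_le e Q M.
  have [kQ dk] := IH Q PQ QM; rewrite -eD //; split=> // d dP; apply/negP=> edk.
  have du : ~~ gle e d u by apply: contra ku; apply: gle_trans; apply: gle_edge.
  by have := dk d; rewrite eD // edk => /(_ dP).
pose B := A :\ u.
have upB : upclosed e B.
  move=> x y xy; rewrite !in_setD1 => /andP[xu xA]; rewrite (upA x y xy xA) andbT.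
  by apply: contraNneq xu => yu; apply/eqP/minu => //; rewrite -yu.
have [sQ _] := up_step_region acyclic_e upA PQ sP.
have sQB : Q.2 \subset B by rewrite subsetD1 sQ (complete_disjoint cQ uQ).
have sMB : M.2 \subset B by rewrite M2 sub1set in_setD1 neq_ku.
have [Y [cY YQ] [sY Y1]] := region_min upB cQ sQB.
have [Y' [cY' YM] [sY' Y1']] := region_min upB cM sMB.
have YY' : Y' = Y.
  apply: (complete_eq acyclic_e upB) => // x xB.
  by rewrite (negbTE (Y1 x xB)) (negbTE (Y1' x xB)).
have [Z [cZ ZQ ZM glb]] := meets Q M cQ cM.
have PZ : pair_le e P Z by apply: glb => //; apply: pair_le_step.
have YZ : pair_le e Y Z by apply: glb => //; rewrite -YY'.
have [sZ _] := pair_le_region acyclic_e upB YZ sY.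
case: (flip_minimal_cover upA minu cP sP PQ xQ PZ ZQ) => ZE; last by rewrite -ZE.
by move: sZ; rewrite ZE subsetD1 uP andbF.
Qed.

End Lattice.

(** * Join- and meet-density *)

Section Density.

Variables (T : finType) (e : rel T).
Hypothesis acyclic_e : acyclic e.
Hypothesis joins : has_joins e.
Implicit Types (A B D U : {set T}) (P Q : {set T} * {set T}).

Lemma has_meets_converse : has_meets (converse e).
Proof.
move=> P Q /complete_converse cP /complete_converse cQ.
have [Z [cZ PZ QZ lub]] := joins cP cQ.
exists (swap Z); split; first exact: complete_converse.
- by have := pair_le_converse PZ; rewrite swapK.
- by have := pair_le_converse QZ; rewrite swapK.
- move=> W /complete_converse cW /pair_le_converse WP /pair_le_converse WQ.
  by have := pair_le_converse (lub _ cW WP WQ); rewrite swapK.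
Qed.

Lemma join_irr_le_inv P J g : complete e P -> complete e J -> J.1 = [set g] ->
  pair_le e J P -> g \notin P.2 /\ {in P.2, forall u, ~~ e g u}.
Proof.
move=> /complete_converse cP /complete_converse cJ J1 /pair_le_converse JP.
exact: (le_meet_irr_inv (acyclic_converse acyclic_e) has_meets_converse cP cJ).
Qed.

End Density.

Lemma pair_le_last (T : finType) (e : rel T) P Q :
  pair_le e P Q -> P = Q \/ exists2 X, pair_le e P X & up_step e X Q.
Proof.
move/(@clos_rt_rtn1 _ _ _ _); case=> [|X {}Q XQ PX]; first by left.
by right; exists X => //; apply: clos_rtn1_rt.
Qed.

(** If the meet Z of X and Y is not X, it lies below some W from which X arises by
    a flip at a vertex d. The join-irreducible J of d is then below X, hence below
    Y, Z and W, but d is in the second set of W. *)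
Lemma join_dense_tops (T : finType) (e : rel T) X Y :
  acyclic e -> has_meets e -> has_joins e -> complete e X -> complete e Y ->
  (forall g J, complete e J -> J.1 = [set g] -> pair_le e J X -> pair_le e J Y) ->
  pair_le e X Y.
Proof.
move=> acyclic_e meets joins cX cY dense; have [Z [cZ ZX ZY glb]] := meets X Y cX cY.
case: (pair_le_last ZX) => [<-//|[W ZW [cW _ [d xd]]]].
have [dW dX _ _] := xd.
have ind : {in [set d] &, forall x y, ~~ e x y}.
  by move=> x y /set1P-> /set1P->; rewrite edge_irrefl.
have [J cJ J1] := independent_complete acyclic_e ind.
have JX : pair_le e J X.
  apply: (join_irr_le acyclic_e (g := d)) => //; first exact: complete_disjoint cX dX.
  by move=> u uX; exact: complete_no_edge cX dX uX.
have JW : pair_le e J W := pair_le_trans (glb J cJ JX (dense d J cJ J1 JX)) ZW.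
have [] := join_irr_le_inv acyclic_e joins cW cJ J1 JW.
by rewrite dW.
Qed.

Lemma has_joins_converse (T : finType) (e : rel T) :
  has_meets e -> has_joins (converse e).
Proof.
move=> meets P Q /complete_converse cP /complete_converse cQ.
have [Z [cZ ZP ZQ glb]] := meets _ _ cP cQ.
exists (swap Z); split; first exact: complete_converse.
- by have := pair_le_converse ZP; rewrite swapK.
- by have := pair_le_converse ZQ; rewrite swapK.
- move=> W /complete_converse cW /pair_le_converse WP /pair_le_converse WQ.
  by have := pair_le_converse (glb _ cW WP WQ); rewrite swapK.
Qed.

Lemma meet_dense_tops (T : finType) (e : rel T) X Y :
  acyclic e -> has_meets e -> has_joins e -> complete e X -> complete e Y ->
  (forall k M, complete e M -> M.2 = [set k] -> pair_le e Y M -> pair_le e X M) ->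
  pair_le e X Y.
Proof.
move=> acyclic_e meets joins cX cY dense; rewrite -(swapK X) -(swapK Y).
apply: (@pair_le_converse _ (converse e)).
apply: join_dense_tops; try exact: complete_converse.
- exact: acyclic_converse.
- exact: has_meets_converse.
- exact: has_joins_converse.
move=> k M cM M1 MY; have cM' := complete_converse cM.
rewrite -(swapK M); apply: pair_le_converse; apply: (dense k) => //.
by rewrite -(swapK Y); apply: (@pair_le_converse _ (converse e)).
Qed.

(** * A poset represented by a digraph determines the digraph *)

Section Representation.

Variables (L : Type) (le : L -> L -> Prop).

(** The poset L embeds densely the context whose incidence is the complement of the
    reflexive closure of e, with objects j and attributes m. *)
Definition represents (T : finType) (e : rel T) (j m : T -> L) : Prop :=
  [/\ forall x y, le (j x) (m y) <-> x <> y /\ ~~ e x y,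
      forall a b, (forall x, le (j x) a -> le (j x) b) -> le a b
    & forall a b, (forall y, le b (m y) -> le a (m y)) -> le a b].

End Representation.

Lemma represents_converse L (le : L -> L -> Prop) (T : finType) (e : rel T) j m :
  represents le e j m -> represents (fun a b => le b a) (converse e) m j.
Proof.
case=> rel jd md; split=> [x y|a b|a b]; [|exact: md|exact: jd].
by rewrite rel; split=> -[neq ne]; split=> // xy; apply: neq.
Qed.

(** An orbit of f with more than one element would be a directed cycle. *)
Lemma fixpoint_of_edge (T : finType) (e : rel T) (f : T -> T) :
  acyclic e -> injective f -> (forall x, x = f x \/ e x (f x)) -> f =1 id.
Proof.
move=> acyclic_e inj_f fe x; case: (fe x) => [//|exf].
have neq : f x != x by apply: contraTneq exf => ->; rewrite edge_irrefl.
suff /(acyclic_e _) orb0 : cycle e (orbit f x) by have := in_orbit f x; rewrite orb0.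
apply: (sub_in_cycle (P := [pred y | f y != y]) (e := frel f)).
- move=> y z; rewrite inE => neq_y _ /= /eqP <-.
  by case: (fe y) => // E; rewrite -E eqxx in neq_y.
- apply/allP=> y; rewrite -fconnect_orbit => /iter_findex <- /=.
  elim: (findex f x y) => //= n; apply: contra => /eqP/inj_f E.
  by apply/eqP.
- exact: cycle_orbit.
Qed.

Section Uniqueness.

Variables (L : Type) (le : L -> L -> Prop).
Hypotheses (le_trans : forall a b c, le a b -> le b c -> le a c)
  (le_anti : forall a b, le a b -> le b a -> a = b).

(** The element j1 x is not below m1 x. By density this is witnessed by some j2 y
    below j1 x, and in turn by some j1 z below j2 y. Then z is x or has an edge to
    x; in the second case j1 x, and so j1 z, would be below m1 z by acyclicity. So
    j2 y lies between j1 x and itself. *)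
Lemma join_irr_match (T1 T2 : finType) (e1 : rel T1) (e2 : rel T2) j1 m1 j2 m2 :
  acyclic e1 -> represents le e1 j1 m1 -> represents le e2 j2 m2 ->
  forall x, exists y, j1 x = j2 y.
Proof.
move=> acyclic1 [rel1 jd1 _] [rel2 jd2 _] x.
have not_xx : ~ le (j1 x) (m1 x) by rewrite rel1 => -[].
have [y yx ym] : exists2 y, le (j2 y) (j1 x) & ~ le (j2 y) (m1 x).
  apply: NNPP => none; apply: not_xx; apply: jd2 => y yx.
  by apply: NNPP => ym; apply: none; exists y.
have [z zy zm] : exists2 z, le (j1 z) (j2 y) & ~ le (j1 z) (m1 x).
  apply: NNPP => none; apply: ym; apply: jd1 => z zy.
  by apply: NNPP => zm; apply: none; exists z.
have zx : le (j1 z) (j1 x) := le_trans zy yx.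
have not_zz : ~ le (j1 z) (m1 z) by rewrite rel1 => -[].
have [ezx|nzx] := boolP (e1 z x).
  case: not_zz; apply: le_trans zx _; rewrite rel1; split.
    by move=> E; rewrite E edge_irrefl in ezx.
  by apply: contraFN (edge_gle acyclic1 ezx) => /gle_edge.
have [E|neq] := eqVneq z x; first by exists y; apply: le_anti => //; rewrite -{1}E.
by case: zm; rewrite rel1; split=> //; apply/eqP.
Qed.

Lemma represents_inj (T : finType) (e : rel T) j m :
  acyclic e -> represents le e j m -> injective j.
Proof.
move=> acyclic_e [rel _ _] x y E.
have sub a b : j a = j b -> a = b \/ e a b.
  move=> ab; have [eab|nab] := boolP (e a b); first by right.
  left; apply/eqP; apply: contraT => /eqP neq.
  have : le (j a) (m b) by rewrite rel.
  by rewrite ab rel => -[].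
case: (sub x y E) => // exy; case: (sub y x (esym E)) => // eyx.
by have := edge_gle acyclic_e exy; rewrite (gle_edge eyx).
Qed.

End Uniqueness.

(** Matching the families j gives a bijection s of the vertices, and matching the
    families m gives another one, t. For every x, s x is equal or adjacent to t x
    because j1 x is not below m1 x; acyclicity forces s = t. *)
Theorem represents_iso (L : Type) (le : L -> L -> Prop)
    (T1 T2 : finType) (e1 : rel T1) (e2 : rel T2) j1 m1 j2 m2 :
  (forall a b c, le a b -> le b c -> le a c) -> (forall a b, le a b -> le b a -> a = b) ->
  acyclic e1 -> acyclic e2 -> represents le e1 j1 m1 -> represents le e2 j2 m2 ->
  digraph_iso e1 e2.
Proof.
move=> letr lean ac1 ac2 r1 r2.
have [s sE] := choice _ (join_irr_match letr lean ac1 r1 r2).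
have [s' s'E] := choice _ (join_irr_match letr lean ac2 r2 r1).
have ler a b c : le b a -> le c b -> le c a by move=> ba cb; apply: letr ba.
have lean' a b : le b a -> le a b -> a = b by move=> ba ab; apply: lean.
have [t tE] := choice _ (join_irr_match ler lean' (acyclic_converse ac1)
  (represents_converse r1) (represents_converse r2)).
have ss' : cancel s s' by move=> x; apply: (represents_inj ac1 r1); rewrite -s'E -sE.
have s's : cancel s' s by move=> x; apply: (represents_inj ac2 r2); rewrite -sE -s'E.
have inj_t : injective t.
  move=> x y E; apply: (represents_inj (acyclic_converse ac1) (represents_converse r1)).
  by rewrite !tE E.
have [rel1 _ _] := r1; have [rel2 _ _] := r2.
have rels x y : x <> y /\ ~~ e1 x y <-> s x <> t y /\ ~~ e2 (s x) (t y).
  by rewrite -rel1 sE tE rel2.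
have st x : s x = t x.
  have /(_ (s x)) : (t \o s') =1 id.
    apply: (fixpoint_of_edge ac2); first exact: inj_comp inj_t (can_inj s's).
    move=> y /=; have [E|neq] := eqVneq y (t (s' y)); first by left.
    right; apply: contraT => ne.
    have /rels[] // : s (s' y) <> t (s' y) /\ ~~ e2 (s (s' y)) (t (s' y)).
    by rewrite s's; split=> //; apply/eqP.
  by rewrite /= ss'.
exists s; first by exists s'.
move=> x y; have := rels x y; rewrite -st => rel_xy.
have [->|neq] := eqVneq x y; first by rewrite !edge_irrefl.
have neq_s : s x <> s y by move=> /(can_inj ss')/eqP; rewrite (negbTE neq).
split=> exy; apply: contraT => ne.
  by have [_] := rel_xy.2 (conj neq_s ne); rewrite exy.
by have [_] := rel_xy.1 (conj (elimN eqP neq) ne); rewrite exy.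
Qed.

(** * The lattice of maximal orthogonal pairs *)

Section Mop.

Variables (T : finType) (e : rel T).
Implicit Types (A B X Y : {set T}) (p q : mop e).

(** The polarities of the incidence relation: x and y are distinct and there is no
    edge from x to y. Maximal orthogonal pairs are its formal concepts. *)
Definition lperp B := [set x | [forall y in B, (x != y) && ~~ e x y]].
Definition rperp A := [set y | [forall x in A, (x != y) && ~~ e x y]].

Lemma perp_galois A B : (A \subset lperp B) = (B \subset rperp A).
Proof.
apply/subsetP/subsetP => sub x xA; rewrite inE; apply/forall_inP => y yB.
  by have := sub y yB; rewrite inE => /forall_inP/(_ x xA).
by have := sub y yB; rewrite inE => /forall_inP/(_ x xA).
Qed.

Lemma weakly_orthogonalE A B : weakly_orthogonal e A B = (A \subset lperp B).
Proof.
apply/andP/subsetP => [[dj /no_edgeP ne] x xA|sub].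
  rewrite inE; apply/forall_inP=> y yB; rewrite ne // andbT.
  by apply: contraTneq yB => <-; rewrite (disjointFr dj xA).
split.
  rewrite disjoint_subset; apply/subsetP=> x xA; rewrite inE; apply/negP => xB.
  by have := sub x xA; rewrite inE => /forall_inP/(_ x xB); rewrite eqxx.
apply/no_edgeP=> x y xA yB; have := sub x xA.
by rewrite inE => /forall_inP/(_ y yB)/andP[].
Qed.

Lemma is_mopP P : reflect (P.1 = lperp P.2 /\ P.2 = rperp P.1) (is_mop e P).
Proof.
apply: (iffP andP) => [[/maxsetP[o1 m1] /maxsetP[_ m2]]|[E1 E2]].
  rewrite weakly_orthogonalE in o1; split.
    by apply/esym/m1; rewrite ?weakly_orthogonalE.
  by apply/esym/m2; rewrite ?weakly_orthogonalE ?perp_galois // -perp_galois.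
split; apply/maxsetP; rewrite weakly_orthogonalE -E1; split=> // B.
  by rewrite weakly_orthogonalE -E1 => sub1 sub2; apply/eqP; rewrite eqEsubset sub1.
rewrite weakly_orthogonalE perp_galois -E2 => sub1 sub2.
by apply/eqP; rewrite eqEsubset sub1.
Qed.

Lemma mop_lE p : (sval p).1 = lperp (sval p).2.
Proof. by case: p => P /= /is_mopP[]. Qed.

Lemma mop_rE p : (sval p).2 = rperp (sval p).1.
Proof. by case: p => P /= /is_mopP[]. Qed.

Lemma sub_lrperp A : A \subset lperp (rperp A).
Proof. by rewrite perp_galois. Qed.

Lemma sub_rlperp B : B \subset rperp (lperp B).
Proof. by rewrite -perp_galois. Qed.

Lemma lperpK B : lperp (rperp (lperp B)) = lperp B.
Proof.
apply/eqP; rewrite eqEsubset sub_lrperp andbT perp_galois.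
exact: subset_trans (sub_rlperp B) (sub_rlperp _).
Qed.

Lemma rperpK A : rperp (lperp (rperp A)) = rperp A.
Proof.
apply/eqP; rewrite eqEsubset sub_rlperp andbT -perp_galois.
exact: subset_trans (sub_lrperp A) (sub_lrperp _).
Qed.

Lemma mop_of_right_subproof B : is_mop e (lperp B, rperp (lperp B)).
Proof. by apply/is_mopP; rewrite /= lperpK. Qed.

Lemma mop_of_left_subproof A : is_mop e (lperp (rperp A), rperp A).
Proof. by apply/is_mopP; rewrite /= rperpK. Qed.

Definition mop_of_right B : mop e :=
  exist (fun P => is_mop e P) _ (mop_of_right_subproof B).
Definition mop_of_left A : mop e :=
  exist (fun P => is_mop e P) _ (mop_of_left_subproof A).

Lemma mop_leE p q : mop_le p q <-> (sval q).2 \subset (sval p).2.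
Proof. by rewrite /mop_le mop_lE (mop_lE q) perp_galois -mop_lE -mop_rE. Qed.

Lemma mop_le_right B p : mop_le p (mop_of_right B) <-> B \subset (sval p).2.
Proof. by rewrite /mop_le /= perp_galois -mop_rE. Qed.

Lemma mop_le_left A p : mop_le (mop_of_left A) p <-> A \subset (sval p).1.
Proof. by rewrite mop_leE /= -perp_galois -mop_lE. Qed.

Lemma mop_le_trans p q r : mop_le p q -> mop_le q r -> mop_le p r.
Proof. exact: subset_trans. Qed.

Lemma mop_le_anti p q : mop_le p q -> mop_le q p -> p = q.
Proof.
move=> pq qp; apply: val_inj; have E : (sval p).1 = (sval q).1.
  by apply/eqP; rewrite eqEsubset; apply/andP; split.
rewrite [LHS]surjective_pairing [RHS]surjective_pairing -!/(sval _).
by rewrite E mop_rE (mop_rE q) E.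
Qed.

Lemma mop_bottom : exists b, forall p, mop_le b p.
Proof. by exists (mop_of_left set0) => p; rewrite mop_le_left sub0set. Qed.

Lemma mop_meets p q : exists r, [/\ mop_le r p, mop_le r q &
  forall w, mop_le w p -> mop_le w q -> mop_le w r].
Proof.
exists (mop_of_right ((sval p).2 :|: (sval q).2)); split.
- by apply/mop_leE; apply: subset_trans (sub_rlperp _); apply: subsetUl.
- by apply/mop_leE; apply: subset_trans (sub_rlperp _); apply: subsetUr.
- by move=> w /mop_leE wp /mop_leE wq; apply/mop_le_right; rewrite subUset wp.
Qed.

Lemma mop_joins p q : exists r, [/\ mop_le p r, mop_le q r &
  forall w, mop_le p w -> mop_le q w -> mop_le r w].
Proof.
exists (mop_of_left ((sval p).1 :|: (sval q).1)); split.
- by apply: subset_trans (sub_lrperp _); apply: subsetUl.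
- by apply: subset_trans (sub_lrperp _); apply: subsetUr.
- by move=> w pw qw; apply/mop_le_left; rewrite subUset; apply/andP.
Qed.

Lemma mop_represents : represents (@mop_le T e) e
  (fun x => mop_of_left [set x]) (fun y => mop_of_right [set y]).
Proof.
split=> [x y|p q pq|p q pq].
- rewrite mop_le_left /= sub1set inE; split.
    by move=> /forall_inP/(_ y (set11 y))/andP[/eqP].
  by case=> /eqP neq ne; apply/forall_inP=> z /set1P->; rewrite neq.
- apply/subsetP=> x; rewrite -!sub1set => /mop_le_left/pq.
  by move/mop_le_left.
- apply/mop_leE/subsetP=> y; rewrite -!sub1set => /mop_le_right/pq.
  by move/mop_le_right.
Qed.

End Mop.

(** * Tops of an independence poset that is a lattice *)

(** The common core of the four clauses of tightness: whichever of them is tested,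
    the in-neighbours of the new vertex x in D are not removed. *)
Lemma complete_saturated (T : finType) (e : rel T) D U (D' : {set T}) x :
  complete e (D, U) -> x \notin D -> x \in D' ->
  {in D, forall d, e d x -> d \in D'} -> ~~ orthogonal e D' U.
Proof.
case=> _ cov xD xD' sub; apply/negP=> /orthogonalP[iD' _ dj ne].
case: (cov x xD (dj x xD')) => -[y /= yP exy].
  by have := iD' y x (sub y yP exy) xD'; rewrite exy.
by have := ne x y xD' yP; rewrite exy.
Qed.

Section Tops.

Variables (T : finType) (e : rel T).
Hypothesis acyclic_e : acyclic e.
Implicit Types (P Q : {set T} * {set T}) (p q : top e).

Lemma complete_is_top P : complete e P -> is_top e P.
Proof.
case: P => D U cP; rewrite /is_top; case: (cP) => -> _ /=.
have cP' := complete_converse cP; apply/and4P; split.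
- apply/forall_inP=> d _; apply/forallP=> x; apply/implyP=> xD; apply/implyP.
  case/andP=> _ dx; apply: (complete_saturated cP xD (setU11 _ _)) => y yD eyx.
  rewrite !inE yD andbT orbC; apply/orP; left.
  by apply: contraTneq dx => <-; rewrite edge_gle.
- apply/forall_inP=> u _; apply/forallP=> x; apply/implyP=> xU; apply/implyP.
  case/andP=> _ xu; rewrite -orthogonal_converse.
  apply: (complete_saturated cP' xU (setU11 _ _)) => y yU exy.
  rewrite !inE yU andbT orbC; apply/orP; left.
  by apply: contraTneq xu => <-; rewrite edge_gle.
- apply/forallP=> x; apply/implyP=> xD.
  by apply: (complete_saturated cP xD (setU11 _ _)) => y yD _; apply: setU1r.
- apply/forallP=> x; apply/implyP=> xU; rewrite -orthogonal_converse.
  by apply: (complete_saturated cP' xU (setU11 _ _)) => y yU _; apply: setU1r.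
Qed.

Lemma top_orthogonal p : orthogonal e (sval p).1 (sval p).2.
Proof. by case: p => P /= /andP[]. Qed.

Lemma flip_step_complete p q : flip_step p q ->
  complete e (sval q) /\ (sval q).1 != set0.
Proof.
case=> g [l [l' [gp lin rlin qE]]].
have gp1 : g \notin (sval p).1.
  by have /orthogonalP[_ _ dj _] := top_orthogonal p; apply: contraL gp; apply: dj.
have ortq := top_orthogonal q; rewrite qE in ortq *; split; first exact: flip_complete.
apply/set0Pn; exists g; have [-> _] := flipE acyclic_e lin rlin gp gp1.
by rewrite setU11.
Qed.

Lemma top_le_last p q : top_le p q ->
  p = q \/ complete e (sval q) /\ (sval q).1 != set0.
Proof.
move/(@clos_rt_rtn1 _ _ _ _); case=> [|r {}q rq _]; first by left.
by right; apply: flip_step_complete rq.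
Qed.

(** Results of flips are complete and have a nonempty first set. Hence both the
    complete pair with empty first set and any incomplete top are minimal, and a
    least element forces them to coincide. *)
Lemma bottom_all_complete : (exists b, forall p, top_le b p) ->
  forall p, complete e (sval p).
Proof.
case=> b bot p.
have ind0 : {in set0 &, forall x y, ~~ e x y} by move=> x y; rewrite inE.
have [P0 cP0 P01] := independent_complete acyclic_e ind0.
pose p0 : top e := exist (fun P => is_top e P) P0 (complete_is_top cP0).
case: (top_le_last (bot p0)) => [bE|[_]]; last first.
  by rewrite /= P01 eqxx.
by case: (top_le_last (bot p)) => [<-|[]//]; rewrite bE.
Qed.

Lemma top_leE : (forall p, complete e (sval p)) ->
  forall p q, top_le p q <-> pair_le e (sval p) (sval q).
Proof.
move=> allc p q; split.
  elim=> [{}p {}q [g [l [l' [gp lin rlin qE]]]]|{}p|{}p r {}q _ IH1 _ IH2].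
  - have [_ xg] := flip_exchange acyclic_e lin rlin (allc p) gp.
    by apply: pair_le_step; split=> //; exists g; rewrite qE.
  - exact: pair_le_refl.
  - exact: pair_le_trans IH2.
move EP: (sval p) => P; move EQ: (sval q) => Q PQ; elim: PQ p q EP EQ => {P Q}.
- move=> P Q [cP cQ [g xg]] p q EP EQ; apply: rt_step.
  have [l lin] := linear_extension_exists acyclic_e.
  have [l' rlin] := reverse_linear_extension_exists acyclic_e.
  exists g, l, l'; have [gP _ _ _] := xg; rewrite EP EQ; split=> //.
  have [cQ' xQ'] := flip_exchange acyclic_e lin rlin cP gP.
  exact: exchange_unique xg xQ'.
- move=> P p q EP EQ; suff -> : p = q by exact: rt_refl.
  by apply: val_inj; rewrite /= EP EQ.
- move=> P R Q PR IH1 _ IH2 p q EP EQ.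
  have cR : complete e R by apply: pair_le_complete PR _; rewrite -EP.
  pose r : top e := exist (fun P => is_top e P) R (complete_is_top cR).
  exact: rt_trans (IH1 p r EP erefl) (IH2 r q erefl EQ).
Qed.

End Tops.

(** The join-irreducibles are the tops whose first set is a singleton, the
    meet-irreducibles those whose second set is one. *)
Lemma tops_represents (T : finType) (e : rel T) (L : Type) (le : L -> L -> Prop)
    (f : top e -> L) :
  acyclic e -> bijective f -> (forall p q, top_le p q <-> le (f p) (f q)) ->
  (exists b, forall a, le b a) ->
  (forall a b, exists c, [/\ le c a, le c b &
     forall d, le d a -> le d b -> le d c]) ->
  (forall a b, exists c, [/\ le a c, le b c &
     forall d, le a d -> le b d -> le c d]) ->
  exists j m, represents le e j m.
Proof.
move=> acyclic_e [f' fK f'K] fle [b0 bot] Lmeets Ljoins.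
have le_top a b : le a b <-> top_le (f' a) (f' b) by rewrite fle !f'K.
have allc : forall p : top e, complete e (sval p).
  apply: bottom_all_complete => //; exists (f' b0) => p.
  by rewrite fle f'K.
have pair_leE a b : le a b <-> pair_le e (sval (f' a)) (sval (f' b)).
  by rewrite le_top top_leE.
have [g gK] : exists g : {set T} * {set T} -> L,
    forall P, complete e P -> sval (f' (g P)) = P.
  apply: (choice (fun P a => complete e P -> sval (f' a) = P)) => P.
  have [cP|nc] := classic (complete e P); last by exists b0.
  by exists (f (exist (fun P => is_top e P) P (complete_is_top acyclic_e cP))); rewrite fK.
have le_g P Q : complete e P -> complete e Q -> le (g P) (g Q) <-> pair_le e P Q.
  by move=> cP cQ; rewrite pair_leE !gK.
have meets : has_meets e.
  move=> P Q cP cQ; have [c [cp cq glb]] := Lmeets (g P) (g Q).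
  exists (sval (f' c)); split=> //.
  - by move/pair_leE: cp; rewrite gK.
  - by move/pair_leE: cq; rewrite gK.
  move=> W cW WP WQ; rewrite -(gK W cW); apply/pair_leE; apply: glb; exact/le_g.
have joins : has_joins e.
  move=> P Q cP cQ; have [c [cp cq lub]] := Ljoins (g P) (g Q).
  exists (sval (f' c)); split=> //.
  - by move/pair_leE: cp; rewrite gK.
  - by move/pair_leE: cq; rewrite gK.
  move=> W cW WP WQ; rewrite -(gK W cW); apply/pair_leE; apply: lub; exact/le_g.
have sing x : {in [set x] &, forall y z, ~~ e y z}.
  by move=> y z /set1P-> /set1P->; rewrite edge_irrefl.
have [J JE] : exists J, forall x, complete e (J x) /\ (J x).1 = [set x].
  apply: (choice (fun x J => complete e J /\ J.1 = [set x])) => x.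
  by have [P cP P1] := independent_complete acyclic_e (sing x); exists P.
have [M ME] : exists M, forall x, complete e (M x) /\ (M x).2 = [set x].
  apply: (choice (fun x M => complete e M /\ M.2 = [set x])) => x.
  have [|P cP P1] := independent_complete (acyclic_converse acyclic_e) (D := [set x]).
    by move=> y z yx zx; apply: sing zx yx.
  by exists (swap P); split=> //; apply: (complete_converse cP).
exists (g \o J), (g \o M); split=> [x y|a b dense|a b dense].
- have [[cJ J1] [cM M2]] := (JE x, ME y); rewrite /= le_g //; split.
    move=> /(le_meet_irr_inv acyclic_e meets cJ cM M2); rewrite J1 => -[xy ne].
    by split; [apply/eqP; rewrite eq_sym -in_set1|apply: ne; rewrite set11].
  case=> /eqP neq ne; apply: (le_meet_irr acyclic_e cJ cM M2); rewrite J1.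
    by rewrite inE eq_sym.
  by move=> d /set1P->.
- apply/pair_leE; apply: join_dense_tops => // x I cI I1 Ia.
  have [cJ J1] := JE x.
  have IJ : I = J x by apply: (complete_eq_down acyclic_e); rewrite ?I1 ?J1.
  by move: (dense x); rewrite /= !pair_leE !gK // -IJ; apply.
- apply/pair_leE; apply: meet_dense_tops => // x I cI I2 Ib.
  have [cM M2] := ME x.
  have IM : I = M x by apply: (complete_eq_up acyclic_e); rewrite ?I2 ?M2.
  by move: (dense x); rewrite /= !pair_leE !gK // -IM; apply.
Qed.

Theorem theorem4p6 (G H : finType) (eG : rel G) (eH : rel H)
    (acyclicG : acyclic eG) (acyclicH : acyclic eH) :
  rel_iso (@top_le G eG) (@mop_le H eH) -> digraph_iso eG eH.
Proof.
case=> f bij_f fle.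
have [j [m jm]] := tops_represents acyclicG bij_f fle (mop_bottom eH)
  (@mop_meets _ eH) (@mop_joins _ eH).
exact: (represents_iso (@mop_le_trans _ eH) (@mop_le_anti _ eH)
  acyclicG acyclicH jm (mop_represents eH)).
Qed.
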